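(* Let $n\ge 2$ and let $D\subsetneq\mathbb{R}^n$ be a bounded domain. Then for every $z\in D$, $$\frac{1}{\delta_D(z)}\le m_D(z)\le \frac{2}{\delta_D(z)}.$$ That is, the metric $m_D$ is bi-Lipschitz equivalent to the quasihyperbolic metric $k_D$ on $D$ (there is a constant $L\ge 1$ with $L^{-1}k_D(x,y)\le m_D(x,y)\le L\,k_D(x,y)$ for all $x,y\in D$).
   Context: For a bounded domain (non-empty open connected set) $D\subsetneq\mathbb{R}^n$, $\delta_D(z)=\inf\{|z-\xi|:\xi\in\partial D\}$ is the Euclidean distance from $z\in D$ to the boundary, $d(D)=\sup\{|x-y|:x,y\in D\}$ is the Euclidean diameter, and the density $m_D(z)$ is $$m_D(z)=\frac{d(D)}{\delta_D(z)\,(d(D)-\delta_D(z))}.$$ The metrics are defined by $m_D(x,y)=\inf_\gamma\int_\gamma m_D(z)\,|dz|$ and $k_D(x,y)=\inf_\gamma\int_\gamma \frac{|dz|}{\delta_D(z)}$ (quasihyperbolic metric), where both infima are over all rectifiable paths $\gamma$ in $D$ joining $x$ to $y$. *)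

(* Defs.v *)
From HB Require Import structures.
From mathcomp Require Import all_boot all_order all_algebra.
From mathcomp Require Import all_classical all_reals all_analysis.

Set Implicit Arguments.
Unset Strict Implicit.
Unset Printing Implicit Defensive.

Import Order.TTheory GRing.Theory Num.Theory.
Import numFieldNormedType.Exports.

Local Open Scope classical_set_scope.
Local Open Scope ring_scope.

(* The library norm on ['rV[R]_n] is the sup norm.  It is used below only
   through the topology and the bounded sets it induces, which are the
   Euclidean ones; every distance and length uses [enorm]. *)
Definition enorm (R : realType) (n : nat) (x : 'rV[R]_n) : R :=
  Num.sqrt (\sum_(i < n) x ord0 i ^+ 2).

Definition domain (R : realType) (n : nat) (D : set 'rV[R]_n) : Prop :=
  [/\ D !=set0, open D & connected D].

Definition boundary (T : topologicalType) (A : set T) : set T :=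
  closure A `\` interior A.

Definition bdist (R : realType) (n : nat) (D : set 'rV[R]_n) (z : 'rV[R]_n) : R :=
  inf [set enorm (z - xi) | xi in boundary D].

Definition diam (R : realType) (n : nat) (D : set 'rV[R]_n) : R :=
  sup [set r | exists x y, [/\ D x, D y & r = enorm (x - y)]].

Definition m_density (R : realType) (n : nat) (D : set 'rV[R]_n)
    (z : 'rV[R]_n) : R :=
  diam D / (bdist D z * (diam D - bdist D z)).

Definition k_density (R : realType) (n : nat) (D : set 'rV[R]_n)
    (z : 'rV[R]_n) : R :=
  (bdist D z)^-1.

(* Vector-valued analogue of [variation]: [s] lists the points of a partition
   of [[a, b]] without its first point [a]. *)
Definition polygonal_length (R : realType) (n : nat) (a b : R)
    (g : R -> 'rV[R]_n) (s : seq R) : R :=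
  let F := g \o nth b (a :: s) in
  \sum_(0 <= i < size s) enorm (F i.+1 - F i).

Definition curve_length (R : realType) (n : nat) (a b : R)
    (g : R -> 'rV[R]_n) : \bar R :=
  ereal_sup [set (polygonal_length a b g s)%:E | s in itv_partition a b].

(* [g] is a path on the parameter interval [[a, b]]; its values outside this
   interval are irrelevant. *)
Definition rectifiable_path (R : realType) (n : nat) (a b : R)
    (g : R -> 'rV[R]_n) : Prop :=
  [/\ a < b, {within `[a, b], continuous g} & (curve_length a b g < +oo)%E].

(* The arc-length parametrization of a rectifiable path, i.e. the map [h] on
   [[0, l]], [l] the length of [g], with [g t = h (length of g on [a, t])]:
   [h u] is the value of [g] at the first time at which the length travelled
   reaches [u]. *)
Definition arclength_param (R : realType) (n : nat) (a b : R)
    (g : R -> 'rV[R]_n) (u : R) : 'rV[R]_n :=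
  g (inf [set t | a <= t <= b /\ (u%:E <= curve_length a t g)%E]).

(* Integral of [rho] along [g] with respect to arc length [|dz|]. *)
Definition line_integral (R : realType) (n : nat) (rho : 'rV[R]_n -> R)
    (a b : R) (g : R -> 'rV[R]_n) : \bar R :=
  (\int[lebesgue_measure]_(u in `[0%R, fine (curve_length a b g)])
     (rho (arclength_param a b g u))%:E)%E.

Definition density_metric (R : realType) (n : nat) (rho : 'rV[R]_n -> R)
    (D : set 'rV[R]_n) (x y : 'rV[R]_n) : \bar R :=
  ereal_inf [set I | exists (a b : R) (g : R -> 'rV[R]_n),
    [/\ rectifiable_path a b g, g @` `[a, b] `<=` D, g a = x, g b = y &
        I = line_integral rho a b g]].

Definition m_metric (R : realType) (n : nat) (D : set 'rV[R]_n) :=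
  density_metric (m_density D) D.

Definition k_metric (R : realType) (n : nat) (D : set 'rV[R]_n) :=
  density_metric (k_density D) D.

Definition bilipschitz_equivalent (R : realType) (T : Type) (D : set T)
    (d1 d2 : T -> T -> \bar R) : Prop :=
  exists L : R, 1 <= L /\ forall x y, D x -> D y ->
    (L^-1%:E * d2 x y <= d1 x y)%E /\ (d1 x y <= L%:E * d2 x y)%E.

(* Main.v *)
Require Import Defs.
From HB Require Import structures.
From mathcomp Require Import all_boot all_order all_algebra.
From mathcomp Require Import all_classical all_reals all_analysis.
From mathcomp Require Import lra.
Import Order.TTheory GRing.Theory Num.Theory.
Import numFieldNormedType.Exports.
Local Open Scope classical_set_scope.
Local Open Scope ring_scope.

(** Write [d] for the diameter of [D] and [delta] for the distance from [z] to
    the boundary.  Since the density [m_D] is [delta^-1] times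
    [d / (d - delta)], the pointwise bounds say exactly that
    [0 < delta <= d / 2].  Positivity holds because [D] is open.  For the upper
    bound, follow a line through [z] in a unit direction: in either sense, the
    supremum of the parameters at which the line lies in the bounded open set
    [D] gives a boundary point of [D] ([boundary_on_line]), so [D] contains
    points of the line beyond any distance smaller than [delta]
    ([line_reaches_bdist]); two such points on opposite sides of [z] give
    [2 * delta <= d] ([bdist_le_half_diam]).

    Pointwise domination [rho1 <= c * rho2] on [D] passes to line integrals,
    because the arc-length parametrization of a path in [D] stays in [D], and
    then to the infima over paths ([density_metric_le]).  Applied to the two
    densities in both orders with [c = 2], this gives the equivalence of the
    metrics with [L = 2].  No measurability of the densities along the path is
    needed: the integral of a nonnegative function is a supremum of integrals
    of simple functions below it, which makes it monotone and positively
    homogeneous for all functions ([ge0_le_integral_scale]). *)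

(** * Euclidean norm *)

Lemma enorm_ge0 (R : realType) (n : nat) (x : 'rV[R]_n) : 0 <= enorm x.
Proof. exact: sqrtr_ge0. Qed.

Lemma enormN (R : realType) (n : nat) (x : 'rV[R]_n) : enorm (- x) = enorm x.
Proof.
by rewrite /enorm; congr Num.sqrt; apply: eq_bigr => i _; rewrite !mxE sqrrN.
Qed.

Lemma enormZ (R : realType) (n : nat) (a : R) (x : 'rV[R]_n) :
  enorm (a *: x) = `|a| * enorm x.
Proof.
rewrite /enorm -sqrtr_sqr -sqrtrM ?sqr_ge0// mulr_sumr.
by congr Num.sqrt; apply: eq_bigr => i _; rewrite !mxE exprMn.
Qed.

Lemma enorm_delta (R : realType) (n : nat) (i : 'I_n) :
  enorm (delta_mx ord0 i : 'rV[R]_n) = 1.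
Proof.
rewrite /enorm (bigD1 i)//= big1 => [|j ji]; rewrite !mxE eqxx/=.
  by rewrite eqxx expr1n addr0 sqrtr1.
by rewrite (negbTE ji) expr0n.
Qed.

Lemma norm_le_enorm (R : realType) (n : nat) (x : 'rV[R]_n) : `|x| <= enorm x.
Proof.
rewrite /Num.norm/= mx_normrE; apply: bigmax_le => [|[i j] _ /=].
  exact: enorm_ge0.
rewrite (ord1 i) -sqrtr_sqr ler_wsqrtr// (bigD1 j)//= lerDl.
by apply: sumr_ge0 => k _; exact: sqr_ge0.
Qed.

Lemma enorm_le_norm (R : realType) (n : nat) (x : 'rV[R]_n) :
  enorm x <= Num.sqrt n%:R * `|x|.
Proof.
rewrite -[X in _ * X]ger0_norm// -sqrtr_sqr -sqrtrM// ler_wsqrtr//.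
have -> : n%:R * `|x| ^+ 2 = \sum_(i < n) `|x| ^+ 2.
  by rewrite sumr_const card_ord mulr_natl.
apply: ler_sum => i _; rewrite -real_normK ?num_real// lerXn2r ?nnegrE//.
rewrite [leRHS]/Num.norm/= mx_normrE.
exact: (le_bigmax _ (fun ij : 'I_1 * 'I_n => `|x ij.1 ij.2|) (ord0, i)).
Qed.

(** * Distance to the boundary and diameter *)

Lemma enorm_le_diam (R : realType) (n : nat) (D : set 'rV[R]_n) x y :
  bounded_set D -> D x -> D y -> enorm (x - y) <= diam D.
Proof.
move=> /pinfty_ex_gt0[M M0 DM] Dx Dy; apply: ub_le_sup; last by exists x, y.
exists (Num.sqrt n%:R * (M + M)) => _ [u [v [Du Dv ->]]].
apply: le_trans (enorm_le_norm _ _ _) _; rewrite ler_wpM2l ?sqrtr_ge0//.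
by rewrite (le_trans (ler_normB _ _))// lerD// DM.
Qed.

Lemma bdist_le (R : realType) (n : nat) (D : set 'rV[R]_n) z xi :
  boundary D xi -> bdist D z <= enorm (z - xi).
Proof.
move=> Dxi; apply: ge_inf; last by exists xi.
by exists 0 => _ [x _ <-]; exact: enorm_ge0.
Qed.

(** The last parameter at which a line meets a bounded open set gives a
    boundary point of that set. *)
Lemma boundary_on_line (R : realType) (n : nat) (D : set 'rV[R]_n) z e :
    open D -> D z -> has_ubound [set t : R | D (z + t *: e)] ->
  boundary D (z + sup [set t : R | D (z + t *: e)] *: e).
Proof.
move=> oD Dz; set A := [set t | _] => Aub.
have A0 : A !=set0 by exists 0; rewrite /A/= scale0r addr0.
have phic : continuous (fun t : R => z + t *: e).
  by move=> t; apply: cvgD; [exact: cvg_cst|exact: scalel_continuous].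
split=> [B nB|].
  have [t [At Bt]] := closure_sup A0 Aub (phic _ _ nB).
  by exists (z + t *: e).
rewrite (interior_id _).1// => Dp.
have /nbhs_ballP[r /= r0 rA] : nbhs (sup A) A.
  by apply: phic; exact: open_nbhs_nbhs.
(* If the limit point were in [D], the line would still be in [D] slightly
   beyond the supremum. *)
have : A (sup A + r / 2).
  apply: rA; rewrite -ball_normE/= opprD addrA subrr sub0r normrN.
  by rewrite gtr0_norm ?divr_gt0//; lra.
by move/(ub_le_sup Aub); lra.
Qed.

Lemma line_ubound (R : realType) (n : nat) (D : set 'rV[R]_n) z e :
    bounded_set D -> enorm e = 1 -> D z ->
  has_ubound [set t : R | D (z + t *: e)].
Proof.
move=> bD e1 Dz; exists (diam D) => t /= Dt.
apply: le_trans (enorm_le_diam _ _ _ _ _ bD Dt Dz).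
by rewrite addrAC subrr add0r enormZ e1 mulr1 ler_norm.
Qed.

(** Boundedness forces the line to leave [D], which it can only do at distance
    at least [bdist D z] from [z]. *)
Lemma line_reaches_bdist (R : realType) (n : nat) (D : set 'rV[R]_n) z e s :
    open D -> bounded_set D -> enorm e = 1 -> D z -> s < bdist D z ->
  exists2 t, s < t & D (z + t *: e).
Proof.
move=> oD bD e1 Dz sd.
have ubA := line_ubound _ _ _ _ _ bD e1 Dz.
have bA := boundary_on_line _ _ _ _ _ oD Dz ubA.
have A0 : [set t : R | D (z + t *: e)] 0 by rewrite /= scale0r addr0.
have ssup : s < sup [set t : R | D (z + t *: e)].
  apply: (lt_le_trans sd); apply: le_trans (bdist_le _ _ _ _ _ bA) _.
  rewrite opprD addrA subrr sub0r enormN enormZ e1 mulr1.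
  by rewrite ger0_norm// ub_le_sup.
by have [t At st] := sup_gt (ex_intro _ 0 A0) ssup; exists t.
Qed.

Lemma bdist_le_half_diam (R : realType) (n : nat) (D : set 'rV[R]_n) z :
    (0 < n)%N -> open D -> bounded_set D -> D z ->
  bdist D z <= diam D / 2.
Proof.
move=> n0 oD bD Dz; rewrite leNgt; apply/negP => ltd.
pose e : 'rV[R]_n := delta_mx ord0 (Ordinal n0).
have e1 : enorm e = 1 by exact: enorm_delta.
have [t st Dt] := line_reaches_bdist _ _ _ _ _ _ oD bD e1 Dz ltd.
have e1' : enorm (- e) = 1 by rewrite enormN.
have [u su Du] := line_reaches_bdist _ _ _ _ _ _ oD bD e1' Dz ltd.
have := enorm_le_diam _ _ _ _ _ bD Dt Du.
have -> : z + t *: e - (z + u *: - e) = (t + u) *: e.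
  by rewrite scalerN opprD opprK addrACA subrr add0r scalerDl.
rewrite enormZ e1 mulr1 => /(le_trans (ler_norm _)); lra.
Qed.

Lemma bdist_gt0 (R : realType) (n : nat) (D : set 'rV[R]_n) z :
    (0 < n)%N -> open D -> bounded_set D -> D z ->
  0 < bdist D z.
Proof.
move=> n0 oD bD Dz.
have /nbhs_ballP[r /= r0 rD] : nbhs z D by exact: open_nbhs_nbhs.
apply: (lt_le_trans r0); apply: lb_le_inf.
  pose e : 'rV[R]_n := delta_mx ord0 (Ordinal n0).
  have e1 : enorm e = 1 by exact: enorm_delta.
  by apply: image_nonempty; eexists; apply: (boundary_on_line _ _ _ z e) => //;
    exact: line_ubound.
move=> _ [xi [_ +] <-]; rewrite (interior_id _).1// => nDxi.
apply: le_trans (norm_le_enorm _ _ _); rewrite leNgt; apply/negP => lt_r.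
by apply: nDxi; apply: rD; rewrite -ball_normE.
Qed.

(** * Comparison of metrics given by densities *)

(** No measurability is assumed of [f1] and [f2]. *)
Lemma ge0_le_integral_scale d (T : measurableType d) (R : realType)
    (mu : {measure set T -> \bar R}) (D : set T) (f1 f2 : T -> R) (c : R) :
    0 < c -> (forall x, D x -> 0 <= f1 x) -> (forall x, D x -> 0 <= f2 x) ->
    (forall x, D x -> f1 x <= c * f2 x) ->
  (\int[mu]_(x in D) (f1 x)%:E <= c%:E * \int[mu]_(x in D) (f2 x)%:E)%E.
Proof.
move=> c0 f10 f20 f12.
rewrite ge0_integralE; last by move=> x Dx; rewrite lee_fin f10.
rewrite ge0_integralE; last by move=> x Dx; rewrite lee_fin f20.
apply: ge_ereal_sup => _ [h /= hf1 <-].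
have c1 : 0 <= c^-1 by rewrite invr_ge0 ltW.
rewrite -lee_pdivrMl// -sintegralrM.
apply: ereal_sup_ubound; exists (scale_nnsfun h c1) => //= x.
move: (hf1 x); rewrite /patch/=; case: ifPn => [|_].
  rewrite inE => Dx; rewrite !lee_fin => hx.
  by rewrite ler_pdivrMl// (le_trans hx)// f12.
by rewrite !lee_fin => hx; rewrite pmulr_rle0 ?invr_gt0.
Qed.

Lemma curve_length_ge0 (R : realType) (n : nat) (a b : R) (g : R -> 'rV[R]_n) :
  a < b -> (0 <= curve_length a b g)%E.
Proof.
move=> ab; apply: (@le_trans _ _ (polygonal_length a b g [:: b])%:E).
  by rewrite lee_fin; apply: sumr_ge0 => i _; exact: enorm_ge0.
by apply: ereal_sup_ubound; exists [:: b] => //; exact: itv_partition1.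
Qed.

(** The length bound makes the set of times defining the arc-length
    parametrization nonempty, as it contains [b], so that its infimum lies in
    [[a, b]]. *)
Lemma arclength_param_in (R : realType) (n : nat) (D : set 'rV[R]_n) (a b u : R)
    (g : R -> 'rV[R]_n) :
    rectifiable_path a b g -> g @` `[a, b] `<=` D ->
    u <= fine (curve_length a b g) ->
  D (arclength_param a b g u).
Proof.
move=> [ab _ lfin] gD ul; apply: gD; eexists => //.
rewrite /= in_itv/=; set S := [set t | _].
have Sb : S b.
  split; first by rewrite ltW//=.
  by rewrite -[leRHS]fineK ?lee_fin// ge0_fin_numE ?curve_length_ge0.
have Sa : lbound S a by move=> t [/andP[]].
by apply/andP; split; [apply: lb_le_inf => //; exists b|apply: ge_inf => //; exists a].
Qed.

Lemma density_metric_le (R : realType) (n : nat) (D : set 'rV[R]_n)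
    (rho1 rho2 : 'rV[R]_n -> R) (c : R) (x y : 'rV[R]_n) :
    0 < c -> (forall z, D z -> 0 <= rho1 z) -> (forall z, D z -> 0 <= rho2 z) ->
    (forall z, D z -> rho1 z <= c * rho2 z) ->
  (density_metric rho1 D x y <= c%:E * density_metric rho2 D x y)%E.
Proof.
move=> c0 rho10 rho20 rho12; rewrite -lee_pdivrMl//.
apply: le_ereal_inf_tmp => _ [a [b [g [rg gD ga gb ->]]]].
rewrite lee_pdivrMl//.
apply: (@le_trans _ _ (line_integral rho1 a b g)).
  by apply: ereal_inf_lbound; exists a, b, g.
have inD u : `[0%R, fine (curve_length a b g)]%classic u ->
    D (arclength_param a b g u).
  by rewrite /= in_itv/= => /andP[_ ul]; exact: arclength_param_in gD ul.
by apply: ge0_le_integral_scale => // u /inD;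
  [exact: rho10|exact: rho20|exact: rho12].
Qed.

Theorem theorem3p5 (R : realType) (n : nat) (D : set 'rV[R]_n)
    (hn : (2 <= n)%N) (hdom : domain D) (hproper : D `<` [set: 'rV[R]_n])
    (hbnd : bounded_set D) :
  (forall z, D z ->
     1 / bdist D z <= m_density D z /\ m_density D z <= 2 / bdist D z) /\
  bilipschitz_equivalent D (m_metric D) (k_metric D).
Proof.
have n0 : (0 < n)%N by exact: ltnW.
have [_ oD _] := hdom.
have delta0 z : D z -> 0 < bdist D z by exact: bdist_gt0.
have bounds z : D z ->
    1 / bdist D z <= m_density D z /\ m_density D z <= 2 / bdist D z.
  move=> Dz; have d0 := delta0 _ Dz.
  have dd := bdist_le_half_diam _ _ _ _ n0 oD hbnd Dz.
  have dd0 : 0 < diam D - bdist D z by lra.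
  rewrite /m_density invfM mulrCA ![_ / bdist D z]mulrC.
  split; rewrite ler_pM2l ?invr_gt0//.
    by rewrite ler_pdivlMr//; lra.
  by rewrite ler_pdivrMr//; lra.
split=> //.
have k0 z : D z -> 0 <= k_density D z.
  by move=> /delta0 d0; rewrite invr_ge0 ltW.
have km z : D z -> k_density D z <= m_density D z.
  by move=> /bounds[+ _]; rewrite div1r.
have m0 z : D z -> 0 <= m_density D z.
  by move=> Dz; apply: le_trans (km _ Dz); exact: k0.
exists 2; split; first by lra.
move=> x y _ _; split.
  rewrite lee_pdivrMl//; apply: density_metric_le => // z Dz.
  by apply: le_trans (km _ Dz) _; have := m0 _ Dz; lra.
by apply: density_metric_le => // z /bounds[].
Qed.
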